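(* Each of the two sets $\{Y_{S_1},Y_{C_3},Y_{S_5},Y_{S_7},\dots\}$ and $\{Y_{S_1},Y_{S_3},Y_{S_5},Y_{S_7},\dots\}$ is algebraically independent over $\mathbb{Q}$ and generates $\Gamma$, i.e. $$\Gamma=\mathbb{Q}[Y_{S_1},Y_{C_3},Y_{S_5},Y_{S_7},\dots]=\mathbb{Q}[Y_{S_1},Y_{S_3},Y_{S_5},Y_{S_7},\dots].$$ Moreover, these are the only algebraically independent generating sets of $\Gamma$ consisting of near chromatic symmetric functions $Y_G$ of finite simple graphs $G$.
   Context: For a finite simple graph $G$, $X_G$ is its chromatic symmetric function (the sum over proper colorings $\kappa$ of $\prod_v x_{\kappa(v)}$), $\omega$ is the involution on symmetric functions with $\omega(p_r)=(-1)^{r-1}p_r$, and $Y_G=(X_G+\omega(X_G))/2$ is the near chromatic symmetric function. $\Gamma=\mathbb{Q}[p_1,p_3,p_5,\dots]$ where $p_r$ are power sums. $C_3$ is the cycle on three vertices and $S_n$ is the tree on $n$ vertices with one internal vertex and $n-1$ leaves. *)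

(* Defs.v *)
From HB Require Import structures.
From mathcomp Require Import all_boot all_order all_algebra.
From mathcomp Require Import mpoly.
From Stdlib Require Import ClassicalEpsilon.
Set Implicit Arguments. Unset Strict Implicit. Unset Printing Implicit Defensive.
Import GRing.Theory.
Local Open Scope ring_scope.

(* A symmetric function over Q (in countably many variables x_0, x_1, ...)
   is represented by the family of its restrictions to the first N variables
   (set x_j = 0 for j >= N), for every N.  Restriction is an injective ring
   morphism, so equalities/polynomial relations in Lambda_Q are exactly the
   componentwise ones. *)
Definition SF := forall N : nat, {mpoly rat[N]}.

Definition sf0 : SF := fun N => 0.

Definition psum (r : nat) : SF := fun N => \sum_(i < N) 'X_i ^+ r.

Definition sfeval (k : nat) (Q : {mpoly rat[k]}) (F : 'I_k -> SF) : SF :=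
  fun N => mmap (@mpolyC N rat) (fun i => F i N) Q.

Record graph := Graph {
  gn : nat;
  gadj : rel 'I_gn;
  gadj_sym : ssrbool.symmetric gadj;
  gadj_irr : irreflexive gadj }.

Definition proper (G : graph) (N : nat) (k : {ffun 'I_(gn G) -> 'I_N}) : bool :=
  [forall u, forall v, gadj u v ==> (k u != k v)].

Definition chromSF (G : graph) : SF := fun N =>
  \sum_(k : {ffun 'I_(gn G) -> 'I_N} | proper k) \prod_(v : 'I_(gn G)) 'X_(k v).

Definition psrep (f : SF) (m : nat) (R : {mpoly rat[m]}) : Prop :=
  f = sfeval R (fun i => psum i.+1).

(* omega: write f as a polynomial in power sums and substitute
   p_r |-> (-1)^(r-1) p_r.  (Every symmetric function has such an
   expression, and the result does not depend on it; the junk value 0 is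
   never used for symmetric functions.) *)
Definition omega (f : SF) : SF :=
  match excluded_middle_informative
          (exists mR : {m : nat & {mpoly rat[m]}}, psrep f (projT2 mR)) with
  | left H =>
      let mR := proj1_sig (constructive_indefinite_description _ H) in
      sfeval (projT2 mR) (fun i => fun N => (-1) ^+ (val i) *: psum i.+1 N)
  | right _ => sf0
  end.

Definition nearSF (G : graph) : SF :=
  fun N => (2%:R^-1 : rat) *: (chromSF G N + omega (chromSF G) N).

Definition inGamma (f : SF) : Prop :=
  exists k (Q : {mpoly rat[k]}), f = sfeval Q (fun i => psum (2 * val i).+1).

Definition alg_indep (T : SF -> Prop) : Prop :=
  forall k (F : 'I_k -> SF) (Q : {mpoly rat[k]}),
    injective F -> (forall i, T (F i)) -> sfeval Q F = sf0 -> Q = 0.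

Definition inAlg (T : SF -> Prop) (f : SF) : Prop :=
  exists k (F : 'I_k -> SF) (Q : {mpoly rat[k]}),
    (forall i, T (F i)) /\ f = sfeval Q F.

Definition generates_Gamma (T : SF -> Prop) : Prop :=
  forall f, inGamma f <-> inAlg T f.

Definition star_adj (n : nat) : rel 'I_n :=
  fun u v => ((val u == 0%N) && (val v != 0%N)) || ((val v == 0%N) && (val u != 0%N)).
Lemma star_sym (n : nat) : ssrbool.symmetric (@star_adj n).
Proof. by move=> u v; rewrite /star_adj orbC. Qed.
Lemma star_irr (n : nat) : irreflexive (@star_adj n).
Proof. by move=> u; rewrite /star_adj; case: (val u == 0%N). Qed.
Definition star (n : nat) : graph := @Graph n (@star_adj n) (@star_sym n) (@star_irr n).

Definition c3_adj : rel 'I_3 := fun u v => u != v.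
Lemma c3_sym : ssrbool.symmetric c3_adj. Proof. by move=> u v; rewrite /c3_adj eq_sym. Qed.
Lemma c3_irr : irreflexive c3_adj. Proof. by move=> u; rewrite /c3_adj eqxx. Qed.
Definition C3 : graph := @Graph 3 c3_adj c3_sym c3_irr.

Definition famA (k : nat) : graph :=
  if k == 1%N then C3 else star (2 * k).+1.
Definition famB (k : nat) : graph := star (2 * k).+1.

Definition setA (f : SF) : Prop := exists k, f = nearSF (famA k).
Definition setB (f : SF) : Prop := exists k, f = nearSF (famB k).

(* Main.v *)
Require Import Defs.
From mathcomp Require Import all_boot all_order all_algebra all_fingroup.
From mathcomp Require Import mpoly zify ring.
From Stdlib Require Import FunctionalExtensionality ClassicalEpsilon.
Set Implicit Arguments. Unset Strict Implicit. Unset Printing Implicit Defensive.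
Import Order.TTheory GRing.Theory Num.Theory.
Local Open Scope ring_scope.

(** A symmetric function that is a polynomial in the power sums is determined by a polynomial
    function of their values [s_0, s_1, ...] (with [s_i] the value of [p_{i+1}]), because the
    power sums of rational points are Zariski dense.  In these coordinates [omega] is
    [s_i |-> (-1)^i s_i] and
    [X_G = \sum_S (-1)^|S| \prod_C s_(|C|-1)], where [S] runs over the sets of edges and [C] over
    the components of [S].

    [Y_{S_{2k+1}}] is [p_{2k+1}] plus a polynomial in [p_1, ..., p_{2k-1}], and
    [Y_{C_3} = p_1^3 + 2 p_3], so both families are triangular in [p_1, p_3, ...].
    Conversely, if [T] generates Gamma, some [Y_G] in [T] has a nonzero linear term in [p_{2k+1}];
    then [G] has [2k+1] vertices, none of them isolated if [k > 0].  As [Y_G] does not involve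
    [p_2], no two edges of [G] are disjoint, so [G] is a star or a triangle.  Hence [T] contains
    one of the two families, and equals it by algebraic independence. *)

(** * Polynomial functions of the power sums *)

(** The lowest digit is the residue modulo [d]; removing it and dividing by [d] gives the induction.
    This makes the Kronecker substitution injective on monomials. *)
Lemma base_expansion_inj d n (f g : 'I_n -> nat) :
    (forall i, f i < d)%N -> (forall i, g i < d)%N ->
  (\sum_i f i * d ^ i = \sum_i g i * d ^ i)%N -> f =1 g.
Proof.
elim: n f g => [|n IHn] f g fd gd; first by move=> _ [].
have E (h : 'I_n.+1 -> nat) :
    (\sum_i h i * d ^ i = (\sum_i h (lift ord0 i) * d ^ i) * d + h ord0)%N.
  rewrite big_ord_recl expn0 muln1 addnC big_distrl /=; congr (_ + _)%N.
  by apply: eq_bigr => i _; rewrite /= /bump add1n expnSr mulnA.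
rewrite !{}E => e.
have e0 : f ord0 = g ord0.
  by have /(congr1 (modn^~ d)) := e; rewrite !modnMDl !modn_small.
have d0 : (0 < d)%N by apply: leq_ltn_trans (fd ord0).
have eS : f \o lift ord0 =1 g \o lift ord0.
  apply: IHn => [i|i|]; [exact: fd | exact: gd |].
  by apply/eqP; rewrite -(eqn_pmul2r d0) -(eqn_add2r (f ord0)) e {1}e0.
by move=> i; case: (unliftP ord0 i) => [j|] -> //; exact: eS.
Qed.

Lemma poly_nat_eq0 (p : {poly rat}) : (forall t : nat, p.[t%:R] = 0) -> p = 0.
Proof.
move=> p0; pose s : seq rat := [seq i%:R | i <- iota 0 (size p)].
apply: (@roots_geq_poly_eq0 _ p s).
- by apply/allP => _ /mapP[i _ ->]; rewrite /root p0.
- by rewrite map_inj_uniq ?iota_uniq // => i j /eqP; rewrite eqr_nat => /eqP.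
- by rewrite size_map size_iota.
Qed.

(* Kronecker substitution X_i |-> t^(d^i). *)
Lemma mpoly_nat_eq0 n (p : {mpoly rat[n]}) :
  (forall x : 'I_n -> nat, p.@[fun i => (x i)%:R] = 0) -> p = 0.
Proof.
move=> p0; set d := msize p.
pose w (m : 'X_{1..n}) := (\sum_i m i * d ^ i)%N.
(* No exponent of a monomial of [p] reaches [d], so [w m] has the exponents of [m] as its base-[d]
   digits. *)
have wI m1 m2 : m1 \in msupp p -> m2 \in msupp p -> w m1 = w m2 -> m1 = m2.
  move=> h1 h2 e; apply/mnmP; apply: (base_expansion_inj _ _ e) => i.
    by apply: leq_ltn_trans (msize_mdeg_lt h1); rewrite mdegE (bigD1 i) //= leq_addr.
  by apply: leq_ltn_trans (msize_mdeg_lt h2); rewrite mdegE (bigD1 i) //= leq_addr.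
pose P : {poly rat} := \sum_(m <- msupp p) p@_m *: 'X^(w m).
have P0 : P = 0.
  apply: poly_nat_eq0 => t; rewrite -(p0 (fun i => t ^ (d ^ i))%N) mevalE /P.
  rewrite horner_sum; apply: eq_bigr => m _; rewrite hornerZ hornerXn; congr (_ * _).
  rewrite /w; apply: (big_ind2 (fun a b => t%:R ^+ a = b)) => //.
    by move=> a1 b1 a2 b2 <- <-; rewrite exprD.
  by move=> i _; rewrite natrX -exprM mulnC.
apply/mpolyP => m; rewrite mcoeff0; case: (boolP (m \in msupp p)) => [hm|]; last first.
  exact: memN_msupp_eq0.
have := congr1 (fun q : {poly rat} => q`_(w m)) P0; rewrite coef0 /P coef_sum.
rewrite (bigD1_seq m) ?msupp_uniq //= coefZ coefXn eqxx mulr1.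
rewrite big_seq_cond big1 ?addr0 // => m' /andP[hm' ne].
rewrite coefZ coefXn; case: eqP => [e|]; last by rewrite mulr0.
by rewrite (wI _ _ hm hm' e) eqxx in ne.
Qed.

Lemma mpoly_eval_eq0 n (p : {mpoly rat[n]}) : (forall x, p.@[x] = 0) -> p = 0.
Proof. by move=> p0; apply: mpoly_nat_eq0. Qed.

Lemma mpoly_eval_inj n (p q : {mpoly rat[n]}) : (forall x, p.@[x] = q.@[x]) -> p = q.
Proof.
move=> e; apply/eqP; rewrite -subr_eq0; apply/eqP/mpoly_eval_eq0 => x.
by rewrite mevalB e subrr.
Qed.

Lemma sfeval_meval k (Q : {mpoly rat[k]}) (F : 'I_k -> SF) N (x : 'I_N -> rat) :
  (sfeval Q F N).@[x] = Q.@[fun i => (F i N).@[x]].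
Proof.
rewrite /sfeval /mmap [RHS]mevalE raddf_sum; apply: eq_bigr => m _ /=.
rewrite mevalM mevalC; congr (_ * _); rewrite /mmap1 rmorph_prod.
by apply: eq_bigr => i _; rewrite rmorphXn.
Qed.

Lemma SF_eval_inj (f g : SF) : (forall N x, (f N).@[x] = (g N).@[x]) -> f = g.
Proof.
by move=> e; apply: functional_extensionality_dep => N; apply: mpoly_eval_inj.
Qed.

Definition polynomial_fun (phi : (nat -> rat) -> rat) : Prop :=
  exists m (R : {mpoly rat[m]}), forall s, phi s = R.@[fun i => s (val i)].

Definition power_sums N (x : 'I_N -> rat) (i : nat) : rat := \sum_l x l ^+ i.+1.

(* [phi s] is the value of [f] when [p_{i+1}] is given the value [s i]. *)
Definition rep (f : SF) (phi : (nat -> rat) -> rat) : Prop :=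
  polynomial_fun phi /\ forall N (x : 'I_N -> rat), (f N).@[x] = phi (power_sums x).

(** Finitely many polynomial functions can thus be written in the same variables, as composition
    needs. *)
Lemma polynomial_fun_widen phi : polynomial_fun phi ->
  exists m0, forall m, (m0 <= m)%N ->
    exists R : {mpoly rat[m]}, forall s, phi s = R.@[fun i => s (val i)].
Proof.
case=> m0 [R E]; exists m0 => m le.
exists (R \mPo [tuple 'X_(widen_ord le i) | i < m0]) => s.
rewrite E comp_mpoly_meval; apply: meval_eq => i.
by rewrite tnth_mktuple mevalXU.
Qed.

Lemma polynomial_fun_ext phi psi : phi =1 psi -> polynomial_fun phi -> polynomial_fun psi.
Proof. by move=> e [m [R E]]; exists m, R => s; rewrite -e. Qed.

Lemma polynomial_fun_comp k (Q : {mpoly rat[k]}) (phi : 'I_k -> (nat -> rat) -> rat) :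
  (forall i, polynomial_fun (phi i)) ->
  polynomial_fun (fun s => Q.@[fun i => phi i s]).
Proof.
move=> h; have /fin_all_exists[m0 H] i := polynomial_fun_widen (h i).
pose M := (\max_i m0 i)%N.
have /fin_all_exists[R E] i := H i M (leq_bigmax i).
exists M, (Q \mPo [tuple R i | i < k]) => s.
by rewrite comp_mpoly_meval; apply: meval_eq => i; rewrite tnth_mktuple E.
Qed.

Lemma polynomial_fun_cst c : polynomial_fun (fun=> c).
Proof. by exists 0%N, c%:MP => s; rewrite mevalC. Qed.

Lemma polynomial_fun_var i : polynomial_fun (fun s => s i).
Proof. by exists i.+1, 'X_(@ord_max i) => s; rewrite mevalXU. Qed.

Lemma polynomial_fun_bin (Q : {mpoly rat[2]}) phi psi :
  polynomial_fun phi -> polynomial_fun psi ->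
  polynomial_fun (fun s => Q.@[fun i => if val i == 0%N then phi s else psi s]).
Proof.
move=> hp hq.
apply: (polynomial_fun_ext (phi := fun s =>
  Q.@[fun i => (if val i == 0%N then phi else psi) s])).
  by move=> s; apply: meval_eq => i; case: ifP.
by apply: polynomial_fun_comp => i; case: ifP.
Qed.

Lemma polynomial_fun_add phi psi : polynomial_fun phi -> polynomial_fun psi ->
  polynomial_fun (fun s => phi s + psi s).
Proof.
move=> hp hq; have := polynomial_fun_bin ('X_ord0 + 'X_ord_max) hp hq.
by apply: polynomial_fun_ext => s; rewrite mevalD !mevalXU.
Qed.

Lemma polynomial_fun_mul phi psi : polynomial_fun phi -> polynomial_fun psi ->
  polynomial_fun (fun s => phi s * psi s).
Proof.
move=> hp hq; have := polynomial_fun_bin ('X_ord0 * 'X_ord_max) hp hq.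
by apply: polynomial_fun_ext => s; rewrite mevalM !mevalXU.
Qed.

Lemma polynomial_fun_sum (I : Type) (r : seq I) (P : pred I) (phi : I -> (nat -> rat) -> rat) :
  (forall i, polynomial_fun (phi i)) ->
  polynomial_fun (fun s => \sum_(i <- r | P i) phi i s).
Proof.
move=> h; elim: r => [|i r IH].
  by apply: polynomial_fun_ext (polynomial_fun_cst 0) => s; rewrite big_nil.
case Pi: (P i); last first.
  by apply: polynomial_fun_ext IH => s; rewrite big_cons Pi.
by apply: polynomial_fun_ext (polynomial_fun_add (h i) IH) => s; rewrite big_cons Pi.
Qed.

Lemma polynomial_fun_prod (I : Type) (r : seq I) (P : pred I) (phi : I -> (nat -> rat) -> rat) :
  (forall i, polynomial_fun (phi i)) ->
  polynomial_fun (fun s => \prod_(i <- r | P i) phi i s).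
Proof.
move=> h; elim: r => [|i r IH].
  by apply: polynomial_fun_ext (polynomial_fun_cst 1) => s; rewrite big_nil.
case Pi: (P i); last first.
  by apply: polynomial_fun_ext IH => s; rewrite big_cons Pi.
by apply: polynomial_fun_ext (polynomial_fun_mul (h i) IH) => s; rewrite big_cons Pi.
Qed.

Lemma polynomial_fun_exp phi e : polynomial_fun phi -> polynomial_fun (fun s => phi s ^+ e).
Proof.
move=> h; elim: e => [|e IH]; first exact: polynomial_fun_cst.
by apply: polynomial_fun_ext (polynomial_fun_mul h IH) => s; rewrite exprS.
Qed.

(* Points with [c j] coordinates equal to [j + 1]. *)
Lemma power_sums_surj_nat m (c : 'I_m -> nat) :
  exists N (x : 'I_N -> rat), forall i,
    power_sums x i = \sum_j (c j)%:R * (j.+1)%:R ^+ i.+1.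
Proof.
pose r : seq rat := flatten [seq nseq (c j) (j.+1)%:R | j <- enum 'I_m].
exists (size r), (fun l => r`_l) => i.
rewrite /power_sums -(big_mkord predT (fun l => r`_l ^+ i.+1)).
rewrite -(big_nth 0 predT (fun a : rat => a ^+ i.+1)) big_flatten big_map.
rewrite big_enum /=; apply: eq_bigr => j _.
by rewrite big_nseq iter_addr_0 mulr_natl.
Qed.

(** A point with $c_j$ coordinates equal to $j+1$ has power sums $Vc$ with $V$ invertible. So
    $R(Vc)$ vanishes for all natural $c$, hence identically, and any prescribed first $m$ power sums
    have the form $Vc$ with $c$ rational. *)
Lemma power_sums_dense phi : polynomial_fun phi ->
  (forall N (x : 'I_N -> rat), phi (power_sums x) = 0) -> forall s, phi s = 0.
Proof.
case=> m [R E] h s.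
(* A Vandermonde matrix with rescaled columns, because the exponents start at 1. *)
pose V : 'M[rat]_m := \matrix_(i, j) (j.+1)%:R ^+ i.+1.
have Vu : V \in unitmx.
  have -> : V = Vandermonde m (\row_j (j.+1)%:R) *m diag_mx (\row_j (j.+1)%:R).
    by apply/matrixP=> i j; rewrite mul_mx_diag !mxE exprSr.
  rewrite unitmxE det_mulmx det_Vandermonde det_diag unitfE mulf_neq0 //.
    apply/prodf_neq0 => i _; apply/prodf_neq0 => j ij; rewrite !mxE subr_eq0 eqr_nat.
    by rewrite eqSS neq_ltn ij orbT.
  by apply/prodf_neq0 => i _; rewrite mxE pnatr_eq0.
pose RV := R \mPo [tuple (\sum_j (V i j)%:MP * 'X_j) | i < m].
have RVE c : RV.@[c] = R.@[fun i => \sum_j V i j * c j].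
  rewrite comp_mpoly_meval; apply: meval_eq => i; rewrite tnth_mktuple raddf_sum.
  by apply: eq_bigr => j _; rewrite /= mevalM mevalC mevalXU.
have RV0 : RV = 0.
  apply: mpoly_nat_eq0 => c; rewrite RVE.
  have [N [x xE]] := power_sums_surj_nat c.
  transitivity (phi (power_sums x)) => //; rewrite E; apply: meval_eq => i; rewrite xE.
  by apply: eq_bigr => j _; rewrite mxE mulrC.
pose c : 'cV[rat]_m := invmx V *m \col_i s (val i).
have := RVE (fun j => c j 0); rewrite RV0 meval0 E => ->; apply: meval_eq => i.
have := congr1 (fun A : 'cV_m => A i 0) (mulKVmx Vu (\col_i s (val i))).
by rewrite !mxE.
Qed.

(** Follows from density of the power sums. This is why [omega f] does not depend on the expression
    chosen for [f]. *)
Lemma rep_unique f phi psi : rep f phi -> rep f psi -> phi =1 psi.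
Proof.
move=> [hp Ep] [hq Eq] s; apply/eqP; rewrite -subr_eq0; apply/eqP.
apply: (power_sums_dense (phi := fun s => phi s - psi s)) => [|N x].
  have := polynomial_fun_add hp (polynomial_fun_mul (polynomial_fun_cst (-1)) hq).
  by apply: polynomial_fun_ext => u; rewrite mulN1r.
by rewrite -Ep -Eq subrr.
Qed.

Lemma rep_inj f g phi psi : rep f phi -> rep g psi -> phi =1 psi -> f = g.
Proof. by move=> [_ ef] [_ eg] e; apply: SF_eval_inj => N x; rewrite ef eg e. Qed.

Lemma rep_ext f phi psi : phi =1 psi -> rep f phi -> rep f psi.
Proof.
by move=> e [h E]; split=> [|N x]; [apply: polynomial_fun_ext h | rewrite E e].
Qed.

Lemma meval_psum N (x : 'I_N -> rat) r : (psum r N).@[x] = \sum_l x l ^+ r.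
Proof.
by rewrite /psum raddf_sum; apply: eq_bigr => l _; rewrite /= rmorphXn /= mevalXU.
Qed.

Lemma rep_psum i : rep (psum i.+1) (fun s => s i).
Proof.
split=> [|N x]; [exact: polynomial_fun_var | exact: meval_psum].
Qed.

Lemma rep_sfeval k (Q : {mpoly rat[k]}) (F : 'I_k -> SF) phi :
  (forall i, rep (F i) (phi i)) -> rep (sfeval Q F) (fun s => Q.@[fun i => phi i s]).
Proof.
move=> h; split=> [|N x]; first by apply: polynomial_fun_comp => i; case: (h i).
by rewrite sfeval_meval; apply: meval_eq => i; case: (h i).
Qed.

Lemma rep_psrep f phi : rep f phi -> exists m (R : {mpoly rat[m]}), psrep f R.
Proof.
move=> hf; have [[m [R E]] _] := hf; exists m, R.
by apply: rep_inj hf (rep_sfeval R (fun i => rep_psum i)) _ => s; rewrite E.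
Qed.

(** Index [i] stands for $p_{i+1}$, so the sign $(-1)^{r-1}$ of $p_r$ becomes $(-1)^i$. *)
Definition signed (s : nat -> rat) (i : nat) : rat := (-1) ^+ i * s i.

Lemma rep_omega f phi : rep f phi -> rep (omega f) (fun s => phi (signed s)).
Proof.
move=> hf; rewrite /omega; case: excluded_middle_informative => [H|[]]; last first.
  by have [m [R h]] := rep_psrep hf; exists (existT _ m R).
case: constructive_indefinite_description => -[m R] /= h.
(* The expression picked by [omega] need not be the one behind [phi], but both define the same
   function. *)
have E : phi =1 (fun s => R.@[fun i => s (val i)]).
  by apply: rep_unique hf _; rewrite h; apply: rep_sfeval => i; apply: rep_psum.
apply: (@rep_ext _ (fun s => R.@[fun i => signed s (val i)])) => [s|]; first by rewrite E.
apply: rep_sfeval => i; split=> [|N x].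
  exact: polynomial_fun_mul (polynomial_fun_cst _) (polynomial_fun_var _).
by rewrite mevalZ meval_psum.
Qed.

Lemma rep_near G phi : rep (chromSF G) phi ->
  rep (nearSF G) (fun s => (phi s + phi (signed s)) / 2%:R).
Proof.
move=> h; have [hp Ep] := h; have [hq Eq] := rep_omega h; split=> [|N x].
  exact: polynomial_fun_mul (polynomial_fun_add hp hq) (polynomial_fun_cst _).
by rewrite /nearSF mevalZ mevalD Ep Eq mulrC.
Qed.

(** * The expansion of the chromatic symmetric function over edge sets *)

Section Components.
Variables (V : finType) (e : rel V).
Hypothesis e_sym : connect_sym e.

Lemma prod_by_component (R : comPzRingType) (F : V -> R) :
  \prod_v F v = \prod_(r in roots e) \prod_(v in connect e r) F v.
Proof.
rewrite (partition_big (fingraph.root e) (roots e)) /=; last by move=> v _; apply: roots_root.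
apply: eq_bigr => r rr; apply: eq_bigl => v.
by rewrite -{1}(eqP rr) eq_sym root_connect.
Qed.

Lemma sum_card_component : (\sum_(r in roots e) #|connect e r| = #|V|)%N.
Proof.
rewrite -[RHS]sum1_card [RHS](partition_big (fingraph.root e) (roots e)) /=; last first.
  by move=> v _; apply: roots_root.
apply: eq_bigr => r rr; rewrite -sum1_card; apply: eq_bigl => v.
by rewrite -{2}(eqP rr) eq_sym root_connect.
Qed.

(** A coloring constant along the edges is a free choice of one color per component. A component of
    size $c$ then contributes $p_c$, stored at index $c-1$. *)
Lemma sum_component_colorings N (x : 'I_N -> rat) :
  \sum_(k : {ffun V -> 'I_N} | [forall u, forall v, e u v ==> (k u == k v)])
     \prod_v x (k v) =
  \prod_(r in roots e) power_sums x (#|connect e r|).-1.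
Proof.
pose S := {r in roots e}.
pose rt v : S := exist (fun r => r \in roots e) _ (roots_root e_sym v).
rewrite [RHS]big_sub.
transitivity (\prod_(r : S) \sum_l x l ^+ #|connect e (val r)|); last first.
  apply: eq_bigr => r _; rewrite /power_sums prednK //.
  by apply/card_gt0P; exists (val r); apply: connect0.
rewrite bigA_distr_bigA /=.
(* Such a coloring is recovered from its values at the roots, by following a path from each vertex
   to its root. *)
rewrite (reindex_onto (fun f : {ffun S -> 'I_N} => [ffun v => f (rt v)])
                      (fun k : {ffun V -> 'I_N} => [ffun r : S => k (val r)])) /=; last first.
  move=> k /'forall_forallP hk; apply/ffunP => v; rewrite !ffunE /=.
  have /connectP[p] := connect_root e v.
  elim: p v => [|w p IH] v /= ; first by move=> _ ->.
  move=> /andP[evw pp] l; move: (hk v w); rewrite evw /= => /eqP ->.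
  have rE : fingraph.root e v = fingraph.root e w.
    by apply/fingraph.rootP => //; apply: connect1.
  by rewrite rE; apply: IH => //; rewrite -rE.
apply: eq_big => [f|f _].
  apply/andP; split.
    apply/'forall_forallP => u v; apply/implyP => euv; rewrite !ffunE; apply/eqP.
    by congr (f _); apply: val_inj; apply/fingraph.rootP => //; apply: connect1.
  apply/eqP/ffunP => r; rewrite !ffunE; congr (f _); apply: val_inj.
  exact/eqP/(valP r).
rewrite prod_by_component big_sub; apply: eq_bigr => r _.
rewrite -prodr_const; apply: eq_bigr => v cv; rewrite ffunE; congr (x (f _)).
by apply: val_inj; rewrite /= -[RHS](eqP (valP r)); apply/esym/fingraph.rootP.
Qed.

End Components.

Definition edge_rel (V : finType) (S : {set V * V}) : rel V :=
  fun u v => ((u, v) \in S) || ((v, u) \in S).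

Lemma edge_rel_sym (V : finType) (S : {set V * V}) : connect_sym (edge_rel S).
Proof. by apply: sym_connect_sym => u v; rewrite /edge_rel orbC. Qed.

(** Each edge is stored once, smaller endpoint first, so that [#|S|] counts edges. *)
Definition edges (G : graph) : {set 'I_(gn G) * 'I_(gn G)} :=
  [set e : 'I_(gn G) * 'I_(gn G) | (e.1 < e.2)%N && gadj e.1 e.2].

Lemma properE G N (k : {ffun 'I_(gn G) -> 'I_N}) :
  Defs.proper k = [forall e in edges G, k e.1 != k e.2].
Proof.
apply/'forall_forallP/forall_inP => [h [u v]|h u v].
  by rewrite inE /= => /andP[_ a]; have := h u v; rewrite a.
apply/implyP => a; case: (ltngtP u v) => uv.
- by apply: (h (u, v)); rewrite inE /= uv.
- by rewrite eq_sym; apply: (h (v, u)); rewrite inE /= uv gadj_sym.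
- by move: a; rewrite (val_inj uv) gadj_irr.
Qed.

Definition component_weight n (S : {set 'I_n * 'I_n}) (s : nat -> rat) : rat :=
  \prod_(r in roots (edge_rel S)) s (#|connect (edge_rel S) r|).-1.

(** Stanley's power sum expansion of $X_G$. *)
Definition chrom_fun (G : graph) (s : nat -> rat) : rat :=
  \sum_(S in powerset (edges G)) (-1) ^+ #|S| * component_weight S s.

(* Expand [\prod_(uv edge) (1 - [k u = k v])] over sets of edges. *)
Lemma rep_chrom G : rep (chromSF G) (chrom_fun G).
Proof.
split=> [|N x].
  apply: polynomial_fun_sum => S; apply: polynomial_fun_mul; first exact: polynomial_fun_cst.
  by apply: polynomial_fun_prod => r; apply: polynomial_fun_var.
rewrite /chromSF raddf_sum /=.
(* Extending the factor by 0 off the edges lets the product run over all pairs; distributing it then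
   produces the sets [S]. *)
pose F k (e : 'I_(gn G) * 'I_(gn G)) : rat := if e \in edges G then - (k e.1 == k e.2 :> 'I_N)%:R else 0.
transitivity (\sum_(k : {ffun 'I_(gn G) -> 'I_N}) (\prod_e (F k e + 1)) * \prod_v x (k v)).
  rewrite [LHS]big_mkcond; apply: eq_bigr => k _; rewrite properE.
  rewrite rmorph_prod /=; under eq_bigr do rewrite mevalXU.
  case: ifPn => [/forall_inP h|/forall_inPn[e he]].
    rewrite [\prod_e (F k e + 1)]big1 ?mul1r // => e _; rewrite /F; case: ifP => [/h/negPf ->|]; by rewrite ?oppr0 add0r.
  by rewrite negbK (bigD1 e) //= {1}/F he => ->; rewrite addNr !mul0r.
under eq_bigr => k _ do rewrite bigA_distr /= big_distrl /=.
rewrite exchange_big /= /chrom_fun [RHS]big_mkcond; apply: eq_bigr => S _.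
rewrite inE; case: ifPn => [SE|/subsetPn[e eS eE]]; last first.
  by rewrite big1 // => k _; rewrite (bigD1 e) //= eS /F (negPf eE) !mul0r.
rewrite /component_weight -sum_component_colorings; last exact: edge_rel_sym.
rewrite [in RHS]big_mkcond big_distrr; apply: eq_bigr => k _ /=.
have -> : \prod_i (if i \in S then F k i else 1) = \prod_(i in S) (-1 * (k i.1 == k i.2)%:R).
  rewrite [RHS]big_mkcond; apply: eq_bigr => i _; case: ifP => // iS.
  by rewrite /F (subsetP SE _ iS) mulN1r.
rewrite big_split prodr_const /= -mulrA; congr (_ * _).
(* The product of the indicators over [S] is 1 if [k] is constant along [S], and 0 otherwise. *)
case: ifP => [/'forall_forallP h|h].
  rewrite big1 ?mul1r // => -[u v] uvS /=.
  by have := h u v; rewrite /edge_rel uvS /= => /eqP ->; rewrite eqxx.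
case: (boolP [exists i in S, k i.1 != k i.2]) => [/exists_inP[i iS ki]|/exists_inPn ne].
  by rewrite (bigD1 i) //= (negPf ki) !mul0r.
case/negP: (negbT h); apply/'forall_forallP => u v.
by apply/implyP => /orP[] /ne /=; rewrite negbK // eq_sym.
Qed.

(** * Stars and the triangle *)

Lemma meval_chrom G N (x : 'I_N -> rat) :
  (chromSF G N).@[x] = \sum_(k : {ffun 'I_(gn G) -> 'I_N} | Defs.proper k) \prod_v x (k v).
Proof.
rewrite /chromSF raddf_sum /=; apply: eq_bigr => k _.
by rewrite rmorph_prod /=; apply: eq_bigr => v _; rewrite mevalXU.
Qed.

Definition star_fun m (s : nat -> rat) : rat :=
  \sum_(i < m.+1) (-1) ^+ i * s 0%N ^+ (m - i) * s i *+ 'C(m, i).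

(** If the center has color $a$, each of the $m$ leaves takes any other color, so $X_G=\sum_a
    x_a(p_1-x_a)^m$; the binomial theorem gives [star_fun]. Allowing any center [c] covers the
    graphs met in the classification. *)
Lemma rep_star G (c : 'I_(gn G)) m : gn G = m.+1 ->
  (forall u v, gadj u v = ((u == c) != (v == c))) -> rep (chromSF G) (star_fun m).
Proof.
move=> gnE adjE; split=> [|N x].
  apply: polynomial_fun_sum => i.
  apply: (@polynomial_fun_ext (fun s => (-1) ^+ i * s 0%N ^+ (m - i) * s i * ('C(m, i))%:R)).
    by move=> s; rewrite mulr_natr.
  apply: polynomial_fun_mul (polynomial_fun_cst _).
  apply: polynomial_fun_mul (polynomial_fun_var _).
  apply: polynomial_fun_mul; first exact: polynomial_fun_cst.
  exact/polynomial_fun_exp/polynomial_fun_var.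
rewrite meval_chrom.
(* The weight of color [j] at vertex [v] when the center is required to have color [a]; improper
   colorings get weight 0. *)
pose F a v j : rat := if v == c then (j == a)%:R * x j else (j != a)%:R * x j.
transitivity (\sum_a \prod_v \sum_j F a v j).
  under [RHS]eq_bigr => a _ do rewrite bigA_distr_bigA /=.
  rewrite exchange_big /= [LHS]big_mkcond; apply: eq_bigr => k _.
  rewrite (bigD1 (k c)) //= [X in _ = _ + X]big1 ?addr0; last first.
    move=> a ka; rewrite (bigD1 c) //= /F eqxx.
    by rewrite eq_sym (negPf ka) !mul0r.
  case: ifPn => [/'forall_forallP h|].
    apply: eq_bigr => v _; rewrite /F; case: (eqVneq v c) => [->|vc].
      by rewrite eqxx mul1r.
    by have := h v c; rewrite adjE eqxx (negPf vc) /= => ->; rewrite mul1r.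
  case/forallPn=> u /forallPn[v]; rewrite negb_imply negbK adjE => /andP[uv /eqP kuv].
  have [w wc kw] : exists2 w, w != c & k w = k c.
    case: (eqVneq u c) uv => [<-|uc] uv; first by exists v => //; rewrite eq_sym; move: uv; case: eqVneq.
    by exists u => //; move: uv; case: (eqVneq v c) => // <-.
  by rewrite (bigD1 w) //= /F (negPf wc) kw eqxx !mul0r.
transitivity (\sum_a x a * (power_sums x 0 - x a) ^+ m).
  apply: eq_bigr => a _; rewrite (bigD1 c) //=; congr (_ * _).
    rewrite (bigD1 a) //= /F !eqxx mul1r big1 ?addr0 // => j ja.
    by rewrite (negPf ja) mul0r.
  have -> : m = #|predC1 c| by rewrite cardC1 card_ord gnE.
  rewrite -prodr_const; apply: eq_bigr => v vc.
  rewrite /power_sums (bigD1 a) //= [in RHS](bigD1 a) //= /F (negPf vc) eqxx mul0r add0r.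
  rewrite expr1 addrAC subrr add0r; apply: eq_bigr => j ja.
  by rewrite (negPf ja) mul1r.
under eq_bigr do rewrite exprBn mulr_sumr.
rewrite exchange_big; apply: eq_bigr => i _ /=.
rewrite {3}/power_sums mulr_sumr -sumrMnl; apply: eq_bigr => a _.
by rewrite mulrnAr exprSr; congr (_ *+ _); ring.
Qed.

Definition near_star_fun m (s : nat -> rat) : rat :=
  \sum_(i < m.+1 | ~~ odd i) (s 0%N ^+ (m - i) * s i) *+ 'C(m, i).

(** [signed] fixes $s_0$ and multiplies $s_i$ by $(-1)^i$, so the average cancels the odd terms of
    [star_fun] and keeps the even ones. *)
Lemma rep_near_star G (c : 'I_(gn G)) m : gn G = m.+1 ->
  (forall u v, gadj u v = ((u == c) != (v == c))) -> rep (nearSF G) (near_star_fun m).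
Proof.
move=> gnE adjE; apply: rep_ext (rep_near (rep_star gnE adjE)) => s.
rewrite /star_fun /near_star_fun -big_split mulr_suml [RHS]big_mkcond /=.
apply: eq_bigr => i _; rewrite /signed expr0 mul1r.
set a := s 0%N ^+ _; set b := s i.
rewrite -signr_odd; case: (odd i) => /=.
  rewrite expr1 -mulrnDl (_ : _ + _ = 0) ?mul0rn ?mul0r //; ring.
by rewrite expr0 !mul1r -mulr2n -[_ *+ 2]mulr_natr mulfK.
Qed.

(** Choosing three distinct colors one after the other, and subtracting the excluded ones each time,
    gives $6e_3=p_1^3-3p_1p_2+2p_3$. *)
Lemma rep_complete3 G : gn G = 3%N -> (forall u v, @gadj G u v = (u != v)) ->
  rep (chromSF G) (fun s => s 0%N ^+ 3 - 3%:R * s 0%N * s 1%N + 2%:R * s 2%N).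
Proof.
case: G => n adj sy ir /= gnE; subst n => adjE; split=> [|N x].
  apply: polynomial_fun_add; last first.
    exact: polynomial_fun_mul (polynomial_fun_cst _) (polynomial_fun_var _).
  apply: polynomial_fun_add; first exact/polynomial_fun_exp/polynomial_fun_var.
  apply: (@polynomial_fun_ext (fun s => - 3%:R * s 0%N * s 1%N)).
    by move=> s; rewrite !mulNr.
  apply: polynomial_fun_mul (polynomial_fun_var _).
  exact: polynomial_fun_mul (polynomial_fun_cst _) (polynomial_fun_var _).
rewrite meval_chrom.
pose h (t : 'I_N * ('I_N * 'I_N)) : {ffun 'I_3 -> 'I_N} :=
  [ffun i : 'I_3 => nth t.1 [:: t.1; t.2.1; t.2.2] i].
pose i0 : 'I_3 := inord 0; pose i1 : 'I_3 := inord 1; pose i2 : 'I_3 := inord 2.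
have v0 : val i0 = 0%N by rewrite /= inordK.
have v1 : val i1 = 1%N by rewrite /= inordK.
have v2 : val i2 = 2%N by rewrite /= inordK.
have I3 (i : 'I_3) : [\/ i = i0, i = i1 | i = i2].
  case: i => -[|[|[|//]]] p; [apply: Or31|apply: Or32|apply: Or33]; apply: val_inj; by rewrite ?v0 ?v1 ?v2.
have n01 : i0 != i1 by rewrite -val_eqE v0 v1.
have n02 : i0 != i2 by rewrite -val_eqE v0 v2.
have n12 : i1 != i2 by rewrite -val_eqE v1 v2.
rewrite (reindex h) /=; last first.
  exists (fun k => (k i0, (k i1, k i2))) => [[a [b c]] _|k _].
    by rewrite !ffunE v0 v1 v2.
  by apply/ffunP=> i; rewrite ffunE; case: (I3 i) => ->; rewrite ?v0 ?v1 ?v2.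
have hE a b c : (h (a, (b, c)) i0 = a) * (h (a, (b, c)) i1 = b) * (h (a, (b, c)) i2 = c).
  by rewrite !ffunE v0 v1 v2.
transitivity (\sum_a \sum_(b | b != a) \sum_(c | (c != a) && (c != b)) x a * (x b * x c)).
  under [RHS]eq_bigr => a _ do rewrite pair_big_dep /=.
  rewrite pair_big_dep /=; apply: eq_big => [[a [b c]]|[a [b c]] _] /=.
    apply/'forall_forallP/and3P => [H|[ba ca cb] u v].
      have := (H i0 i1, H i0 i2, H i1 i2); rewrite /= !adjE n01 n02 n12 !hE /=.
      by rewrite ![a == _]eq_sym ![b == c]eq_sym => -[[-> ->] ->].
    apply/implyP; rewrite /= adjE.
    by case: (I3 u) => ->; case: (I3 v) => ->; rewrite ?eqxx // => _; rewrite !hE // eq_sym.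
  rewrite (bigD1 i0) // (bigD1 i1) /=; last by rewrite eq_sym.
  rewrite (bigD1 i2) /=; last by rewrite ![i2 == _]eq_sym n02 n12.
  rewrite big_pred0 ?hE ?mulr1 // => i; case: (I3 i) => ->; by rewrite ?eqxx ?andbF.
have D (f : 'I_N -> rat) a : \sum_(b | b != a) f b = \sum_b f b - f a.
  by rewrite [in RHS](bigD1 a) //= addrC addrK.
have D2 a b : b != a -> \sum_(c | (c != a) && (c != b)) x a * (x b * x c)
   = x a * x b * (\sum_c x c - x a - x b).
  move=> ba; rewrite -D [in RHS](bigD1 b) //= [x b + _ - _]addrAC subrr add0r mulr_sumr.
  by apply: eq_bigr => c _; ring.
under eq_bigr => a _ do rewrite (eq_bigr _ (D2 a)) D.
set p1 := power_sums x 0.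
have p1E : \sum_c x c = p1 by apply: eq_bigr => i _; rewrite expr1.
rewrite p1E.
have S a : \sum_b x a * x b * (p1 - x a - x b) = x a * (p1 - x a) * p1 - x a * power_sums x 1.
  transitivity (\sum_b (x a * (p1 - x a) * x b - x a * x b ^+ 2)); first by apply: eq_bigr => b _; ring.
  by rewrite sumrB -!mulr_sumr p1E.
under eq_bigr => a _ do rewrite S.
transitivity (\sum_a ((p1 ^+ 2 - power_sums x 1) * x a - 2%:R * p1 * x a ^+ 2 + 2%:R * x a ^+ 3)).
  by apply: eq_bigr => a _; ring.
rewrite big_split sumrB /= -!mulr_sumr p1E /power_sums; ring.
Qed.

Lemma rep_near_complete3 G : gn G = 3%N -> (forall u v, @gadj G u v = (u != v)) ->
  rep (nearSF G) (fun s => s 0%N ^+ 3 + 2%:R * s 2%N).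
Proof.
move=> gnE adjE; apply: rep_ext (rep_near (rep_complete3 gnE adjE)) => s.
by rewrite /signed expr0 expr1 expr2; field.
Qed.

(** * Triangular families *)

Definition in_range (Y : nat -> SF) (f : SF) : Prop := exists k, f = Y k.

Lemma inAlg_gen (T : SF -> Prop) f : T f -> inAlg T f.
Proof.
move=> Tf; exists 1%N, (fun=> f), 'X_ord0; split=> //.
by apply: SF_eval_inj => N x; rewrite sfeval_meval mevalXU.
Qed.

(** The generators used by all the [F i] are gathered into one family, indexed by a disjoint union;
    repetitions are harmless in [inAlg]. *)
Lemma inAlg_sfeval (T : SF -> Prop) k (Q : {mpoly rat[k]}) (F : 'I_k -> SF) :
  (forall i, inAlg T (F i)) -> inAlg T (sfeval Q F).
Proof.
move=> /fin_all_exists[n /fin_all_exists[F0 /fin_all_exists[R h]]].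
pose J : finType := {i : 'I_k & 'I_(n i)}.
exists #|J|, (fun j => F0 _ (tagged (enum_val j))).
exists (Q \mPo [tuple R i \mPo [tuple 'X_(enum_rank (Tagged (fun i => 'I_(n i)) l)) | l < n i] | i < k]).
split=> [j|]; first by case: (h (tag (enum_val j))).
apply: SF_eval_inj => N x; rewrite !sfeval_meval comp_mpoly_meval.
apply: meval_eq => i; rewrite tnth_mktuple comp_mpoly_meval.
case: (h i) => _ ->; rewrite sfeval_meval; apply: meval_eq => l.
by rewrite tnth_mktuple mevalXU enum_rankK.
Qed.

Lemma inAlg_subset (T U : SF -> Prop) f :
  (forall g, T g -> inAlg U g) -> inAlg T f -> inAlg U f.
Proof. by move=> TU [k [F [Q [TF ->]]]]; apply: inAlg_sfeval => i; apply: TU. Qed.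

Lemma inAlg_rangeP (Y : nat -> SF) f : inAlg (in_range Y) f <->
  exists m (Q : {mpoly rat[m]}), f = sfeval Q (fun i => Y (val i)).
Proof.
split=> [[k [F [Q [/fin_all_exists[idx h] ->]]]]|[m [Q ->]]]; last first.
  by exists m, (fun i => Y (val i)), Q; split=> // i; exists (val i).
pose M := (\max_i idx i).+1.
have lt i : (idx i < M)%N by rewrite ltnS leq_bigmax.
exists M, (Q \mPo [tuple 'X_(Ordinal (lt i)) | i < k]).
apply: SF_eval_inj => N x; rewrite !sfeval_meval comp_mpoly_meval.
by apply: meval_eq => i; rewrite tnth_mktuple mevalXU h.
Qed.

Definition odd_psum (i : nat) : SF := psum (2 * i).+1.

Lemma inGammaE f : inGamma f <-> inAlg (in_range odd_psum) f.
Proof. exact: iff_sym (inAlg_rangeP odd_psum f). Qed.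

(** Since $s_{2i}$ is the value of $p_{2i+1}$, each [Y k] lies in Gamma and can be solved for
    $p_{2k+1}$ in terms of earlier odd power sums. *)
Definition triangular (Y : nat -> SF) : Prop := forall k, exists a (Q : {mpoly rat[k]}),
  a != 0 /\ rep (Y k) (fun s => a * s (2 * k)%N + Q.@[fun i => s (2 * val i)%N]).

Section Triangular.
Variable Y : nat -> SF.
Hypothesis triY : triangular Y.

(** The values of the [Y k] can be prescribed freely: coordinate $2M$ is adjusted to fit [Y M], and
    the earlier members do not involve it. *)
Lemma triangular_solve (tau : nat -> rat) M :
  exists s, forall k phi, (k < M)%N -> rep (Y k) phi -> phi s = tau k.
Proof.
elim: M => [|M [s IH]]; first by exists tau.
have [a [Q [a0 rM]]] := triY M.
pose b := (tau M - Q.@[fun i => s (2 * val i)%N]) / a.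
exists (fun i => if i == (2 * M)%N then b else s i) => k phi.
rewrite ltnS leq_eqVlt => /predU1P[->|lt] rk.
  rewrite (rep_unique rk rM) eqxx (@meval_eq _ _ _ (fun i => s (2 * val i)%N)).
    by rewrite /b mulrC divfK // subrK.
  by move=> i; rewrite eqn_mul2l /= (ltn_eqF (ltn_ord i)).
rewrite -(IH k phi lt rk).
have [c [R [_ r]]] := triY k; rewrite !(rep_unique rk r).
rewrite eqn_mul2l /= (ltn_eqF lt); congr (_ + _); apply: meval_eq => i.
by rewrite eqn_mul2l /= (ltn_eqF (ltn_trans (ltn_ord i) lt)).
Qed.

Lemma triangular_rep k : exists phi, rep (Y k) phi.
Proof. by have [a [Q [_ h]]] := triY k; eexists; exact: h. Qed.

Lemma triangular_inj : injective Y.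
Proof.
move=> i j e; apply/eqP/contraT => ne.
have [s hs] := triangular_solve (fun k => (k == i)%:R) (maxn i j).+1.
have [phi r] := triangular_rep i.
have := hs j phi; rewrite -e ltnS leq_maxr eq_sym (negPf ne) => /(_ isT r).
by rewrite (hs i phi) ?ltnS ?leq_maxl // eqxx.
Qed.

(** As the values of the [Y k] are arbitrary, a relation [Q] vanishes at every point [t]. *)
Lemma triangular_alg_indep : alg_indep (in_range Y).
Proof.
move=> k F Q Finj /fin_all_exists[idx FE] Q0; apply: mpoly_eval_eq0 => t.
have idx_inj : injective idx by move=> i j e; apply: Finj; rewrite !FE e.
pose tau n := if [pick i | idx i == n] is Some i then t i else 0.
have tauE i : tau (idx i) = t i.
  rewrite /tau; case: pickP => [j /eqP/idx_inj -> //|/(_ i)]; by rewrite eqxx.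
have [s hs] := triangular_solve tau (\max_i idx i).+1.
have /fin_all_exists[phi r] i : exists phi, rep (F i) phi.
  by rewrite FE; apply: triangular_rep.
have r0 : rep sf0 (fun=> 0).
  by split=> [|N x]; [apply: polynomial_fun_cst | rewrite meval0].
have := rep_sfeval Q r; rewrite Q0 => /rep_unique/(_ r0) /(_ s) <-.
apply: meval_eq => i; rewrite -tauE -(hs _ (phi i)) ?ltnS ?leq_bigmax //.
by rewrite -FE.
Qed.

Lemma triangular_generates : generates_Gamma (in_range Y).
Proof.
move=> f; rewrite inGammaE; split; apply: inAlg_subset => _ [k ->].
  elim/ltn_ind: k => k IH; have [a [Q [a0 r]]] := triY k.
  (* This is $(Y_k-Q(p_1,\dots,p_{2k-1}))/a$, with [Y k] in the last variable. *)
  pose Q' : {mpoly rat[k.+1]} :=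
    a^-1%:MP * ('X_ord_max - (Q \mPo [tuple 'X_(widen_ord (leqnSn k) i) | i < k])).
  pose F (i : 'I_k.+1) := if (i < k)%N then odd_psum i else Y k.
  have -> : odd_psum k = sfeval Q' F.
    pose phi (i : 'I_k.+1) s := if (i < k)%N then s (2 * val i)%N else
       a * s (2 * k)%N + Q.@[fun i => s (2 * val i)%N].
    have rF i : rep (F i) (phi i).
      by rewrite /F /phi; case: ifP => _ //; apply: rep_psum.
    apply: rep_inj (rep_psum _) (rep_sfeval Q' rF) _ => s.
    rewrite mevalM mevalC mevalB mevalXU /phi ltnn comp_mpoly_meval.
    rewrite (@meval_eq _ _ _ (fun i => s (2 * val i)%N) Q); first by rewrite addrK mulKf.
    by move=> i; rewrite tnth_mktuple mevalXU /= ltn_ord.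
  apply: inAlg_sfeval => i; rewrite /F; case: ifP => [/IH //|_].
  by apply: inAlg_gen; exists k.
have [a [Q [_ r]]] := triY k.
pose Q' : {mpoly rat[k.+1]} :=
  a%:MP * 'X_ord_max + (Q \mPo [tuple 'X_(widen_ord (leqnSn k) i) | i < k]).
apply/inAlg_rangeP; exists k.+1, Q'.
apply: rep_inj r (rep_sfeval Q' (fun i => rep_psum _)) _ => s.
rewrite mevalD mevalM mevalC mevalXU comp_mpoly_meval; congr (_ + _).
by apply: meval_eq => i; rewrite tnth_mktuple mevalXU.
Qed.

(* An element of [T] outside [Y] would be a polynomial in [Y], hence dependent on it. *)
Lemma triangular_maximal (T : SF -> Prop) :
  alg_indep T -> generates_Gamma T -> (forall f, in_range Y f -> T f) ->
  forall f, T f <-> in_range Y f.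
Proof.
move=> indT genT YT f; split=> [Tf|]; last exact: YT.
case: (excluded_middle_informative (in_range Y f)) => // nYf.
have : inAlg (in_range Y) f by apply/triangular_generates/genT/inAlg_gen.
move=> /inAlg_rangeP[m [Q fE]]; exfalso.
pose F (i : 'I_m.+1) := if (i < m)%N then Y i else f.
pose Q' : {mpoly rat[m.+1]} := 'X_ord_max - (Q \mPo [tuple 'X_(widen_ord (leqnSn m) i) | i < m]).
have QE t : Q'.@[t] = t ord_max - Q.@[fun i => t (widen_ord (leqnSn m) i)].
  rewrite mevalB mevalXU comp_mpoly_meval; congr (_ - _); apply: meval_eq => i.
  by rewrite tnth_mktuple mevalXU.
have Finj : injective F.
  move=> i j; rewrite /F; case: ltnP => hi; case: ltnP => hj.
  - by move=> /triangular_inj/val_inj.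
  - by move=> e; case: nYf; exists i.
  - by move=> e; case: nYf; exists j.
  - by move=> _; apply: val_inj; apply/eqP; rewrite /= eqn_leq (leq_trans _ hi) ?(leq_trans _ hj) // -ltnS.
have TF i : T (F i) by rewrite /F; case: ifP => // _; apply: YT; exists i.
have Q'0 : Q' = 0.
  apply: indT Finj TF _; apply: SF_eval_inj => N x.
  rewrite sfeval_meval QE meval0 /F ltnn fE sfeval_meval; apply/eqP; rewrite subr_eq0; apply/eqP.
  by apply: meval_eq => i; rewrite /= ltn_ord.
(* If $X_m-Q$ were zero, evaluating with last coordinate $c$ and the others 0 would give $c=Q(0)$
   for every $c$. *)
pose t (c : rat) (i : 'I_m.+1) := if (i < m)%N then 0 else c.
have tE c : c = Q.@[fun=> 0].
  have := QE (t c); rewrite Q'0 meval0 {1}/t ltnn => /esym/eqP; rewrite subr_eq0 => /eqP ->.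
  by apply: meval_eq => i; rewrite /t /= ltn_ord.
by have /eqP := tE 1; rewrite -(tE 0) oner_eq0.
Qed.

End Triangular.

Lemma sum_even_ord (R : nmodType) k (f : nat -> R) :
  \sum_(i < (2 * k).+1 | ~~ odd i) f i = \sum_(i < k.+1) f (2 * i)%N.
Proof.
elim: k => [|k IH]; first by rewrite muln0 big_mkcond !big_ord_recl !big_ord0 /= muln0.
rewrite [RHS]big_ord_recr /= -IH mulnS add2n [LHS]big_mkcond 2!big_ord_recr /= -big_mkcond /=.
by rewrite !negbK mul2n odd_double /= addr0.
Qed.

Lemma star_center n (u v : 'I_n.+1) :
  @gadj (star n.+1) u v = ((u == ord0) != (v == ord0)).
Proof. by rewrite /= /star_adj -!val_eqE /=; case: eqP; case: eqP. Qed.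

Lemma rep_near_star_odd k : rep (nearSF (star (2 * k).+1)) (near_star_fun (2 * k)).
Proof. exact: (@rep_near_star (star (2 * k).+1) ord0 _ erefl (@star_center _)). Qed.

Lemma near_star_fun_odd k s : near_star_fun (2 * k) s =
  s (2 * k)%N + \sum_(i < k) (s 0%N ^+ (2 * k - 2 * i) * s (2 * i)%N) *+ 'C(2 * k, 2 * i).
Proof.
rewrite /near_star_fun (sum_even_ord _ (fun i => (s 0%N ^+ (2 * k - i) * s i) *+ 'C(2 * k, i))).
by rewrite big_ord_recr /= addrC subnn expr0 mul1r binn.
Qed.

Lemma triangular_star k : exists a (Q : {mpoly rat[k]}),
  a != 0 /\ rep (nearSF (star (2 * k).+1))
                (fun s => a * s (2 * k)%N + Q.@[fun i => s (2 * val i)%N]).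
Proof.
suff [Q QE] : exists Q : {mpoly rat[k]}, forall s, Q.@[fun i => s (2 * val i)%N] =
    \sum_(i < k) (s 0%N ^+ (2 * k - 2 * i) * s (2 * i)%N) *+ 'C(2 * k, 2 * i).
  exists 1, Q; split; first exact: oner_neq0.
  by apply: rep_ext (rep_near_star_odd k) => s; rewrite mul1r QE near_star_fun_odd.
(* For $k=0$ the sum is empty and there is no variable to stand for $p_1$. *)
case: k => [|k]; first by exists 0 => s; rewrite meval0 big_ord0.
exists (\sum_(i < k.+1) ('X_ord0 ^+ (2 * k.+1 - 2 * i) * 'X_i) *+ 'C(2 * k.+1, 2 * i)) => s.
rewrite raddf_sum; apply: eq_bigr => i _ /=.
by rewrite mevalMn mevalM rmorphXn /= !mevalXU muln0.
Qed.

Lemma triangular_famB : triangular (fun k => nearSF (famB k)).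
Proof. exact: triangular_star. Qed.

Lemma triangular_famA : triangular (fun k => nearSF (famA k)).
Proof.
move=> k; rewrite /famA; case: eqP => [->|_]; last exact: triangular_star.
exists 2%:R, ('X_ord0 ^+ 3); split=> //.
apply: rep_ext (@rep_near_complete3 C3 erefl (fun u v => erefl)) => s.
by rewrite addrC rmorphXn /= mevalXU.
Qed.

(** * Matchings and membership in Gamma *)

(** Applied below to two points that differ only in the value of $p_2$. *)
Lemma inGamma_rep_even f phi s s' : inGamma f -> rep f phi ->
  (forall i, s (2 * i)%N = s' (2 * i)%N) -> phi s = phi s'.
Proof.
move=> [k [Q ->]] r e.
have := rep_sfeval Q (fun i : 'I_k => rep_psum (2 * i)) => /(rep_unique r) E.
by rewrite !E; apply: meval_eq => i; rewrite e.
Qed.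

Lemma inGamma_rep f : inGamma f -> exists phi, rep f phi.
Proof.
by move=> [k [Q ->]]; eexists; apply: rep_sfeval => i; apply: rep_psum.
Qed.

Lemma mem_connect_other (V : finType) (e : rel V) v :
  (1 < #|connect e v|)%N -> exists w, e v w.
Proof.
move=> c; have /card_gt1P[x [y [hx hy xy]]] := c.
have [w hw wv] : exists2 w, connect e v w & w != v.
  by case: (eqVneq x v) xy => [->|xv] xy; [exists y; rewrite // eq_sym | exists x].
have /connectP[[|z p] /=] := hw; first by move=> _ wE; rewrite wE eqxx in wv.
by move=> /andP[evz _] _; exists z.
Qed.

Section SmallComponents.
Variables (n : nat) (S : {set 'I_n * 'I_n}).
Hypothesis S_lt : forall e, e \in S -> (e.1 < e.2)%N.

(** Given [S_lt], this says that [S] is a matching. *)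
Definition small_components : bool :=
  [forall r, (r \in roots (edge_rel S)) ==> (#|connect (edge_rel S) r| <= 2)%N].

(** Sending an edge to the root of its component is a bijection onto the roots of two-element
    components, as each such component consists of the endpoints of one edge. *)
Lemma card_small_components : small_components ->
  #|[set r in roots (edge_rel S) | #|connect (edge_rel S) r| == 2]| = #|S|.
Proof.
move=> /forall_inP sm; have sy := edge_rel_sym S.
pose rt := fingraph.root (edge_rel S).
have cE v w : (w \in connect (edge_rel S) (rt v)) = connect (edge_rel S) v w.
  by rewrite [LHS](same_connect sy (y := v)) // sy connect_root.
have small v : (#|connect (edge_rel S) v| <= 2)%N.
  have := sm (rt v) (roots_root sy v); congr (_ <= _)%N.
  by apply: eq_card => w; rewrite cE.
have edge_conn (e : 'I_n * 'I_n) : e \in S -> connect (edge_rel S) e.1 e.2.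
  by case: e => a b eS; apply: connect1; rewrite /edge_rel eS.
have compE (e : 'I_n * 'I_n) : e \in S ->
    connect (edge_rel S) (rt e.1) =i [set e.1; e.2].
  move=> eS w; have lt := S_lt eS; rewrite cE.
  have sub : [set e.1; e.2] \subset connect (edge_rel S) e.1.
    by apply/subsetP => x /set2P[] ->; [apply: connect0 | apply: edge_conn].
  have ne : e.1 != e.2 by rewrite -val_eqE /= ltn_eqF.
  have /subset_cardP := sub => -> //.
  apply/eqP; rewrite eqn_leq subset_leq_card //= cards2 ne; exact: small.
rewrite -(card_in_imset (f := fun e : 'I_n * 'I_n => rt e.1)) => [|e e' eS eS' /= rE].
  congr #|pred_of_set _|; apply/setP => r; rewrite !inE; apply/andP/imsetP.
    move=> [rr /eqP c2]; have [w] : exists w, edge_rel S r w.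
      by apply: mem_connect_other; rewrite c2.
    case/orP => h; [exists (r, w) | exists (w, r)] => //=; first by rewrite /rt (eqP rr).
    rewrite -[LHS](eqP rr); apply/fingraph.rootP => //; apply: connect1.
    by rewrite /edge_rel h orbT.
  move=> [e eS ->]; split; first exact: roots_root.
  rewrite (eq_card (compE e eS)) cards2.
  by rewrite -val_eqE /= (ltn_eqF (S_lt eS)).
(* Equal roots give equal endpoint sets; the ordering [S_lt] then makes the pairs equal. *)
have ee' : [set e.1; e.2] =i [set e'.1; e'.2].
  by move=> w; rewrite -!compE // rE.
have l := S_lt eS; have l' := S_lt eS'.
have := ee' e.1; have := ee' e.2; rewrite !inE !eqxx orbT /=.
case: e e' {rE ee' eS eS'} l l' => a b [c d] /= l l'.
case: (eqVneq a c) => [ac|_].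
  case: (eqVneq b c) => [bc|_] /=; first by rewrite ac bc ltnn in l.
  by rewrite ac => /esym/eqP ->.
move=> h2 /esym/eqP ad; rewrite {}ad in l.
case/esym/orP: h2 => /eqP bE; rewrite bE in l; last by rewrite ltnn in l.
by have := ltn_trans l l'; rewrite ltnn.
Qed.

Definition two_point (t : rat) (i : nat) : rat :=
  if i == 0%N then 1 else if i == 1%N then t else 0.

(** Components of size 1 and 2 weigh 1 and [t], larger ones 0; a matching has as many two-element
    components as edges. *)
Lemma component_weight_two_point t :
  component_weight S (two_point t) = if small_components then t ^+ #|S| else 0.
Proof.
rewrite /component_weight; have c0 r : (0 < #|connect (edge_rel S) r|)%N.
  by apply/card_gt0P; exists r; apply: connect0.
case: ifPn => [sm|].
  rewrite -(card_small_components sm) -prodr_const big_mkcond [RHS]big_mkcond.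
  apply: eq_bigr => r _; rewrite inE; case: ifP => //= rr.
  have := forall_inP sm r rr; have := c0 r.
  by case: #|_| => [|[|[|]]].
case/forall_inPn => r rr; rewrite -ltnNge => c3.
by rewrite (bigD1 r) //= /two_point; case: #|_| c3 => [|[|[|]]] // m _; rewrite mul0r.
Qed.
End SmallComponents.

(** The set $\{r,f(r)\}$ is closed under the edges, so it contains the component of $r$. *)
Lemma small_components_involution n (S : {set 'I_n * 'I_n}) (f : 'I_n -> 'I_n) :
  involutive f -> (forall u v, edge_rel S u v -> v = f u) -> small_components S.
Proof.
move=> fK Sf; apply/forall_inP => r _.
apply: (@leq_trans #|[set r; f r]|); last by rewrite cards2; case: (_ != _).
apply/subset_leq_card/subsetP => w; rewrite inE => cw.
have cl : closed (edge_rel S) [set r; f r].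
  apply: (intro_closed (edge_rel_sym S)) => u v /Sf ->.
  by rewrite !inE => /orP[] /eqP ->; rewrite ?fK eqxx ?orbT.
by rewrite -(closed_connect cl cw) set21.
Qed.

Lemma signed_two_point t i : signed (two_point t) i = two_point (- t) i.
Proof.
rewrite /signed /two_point; case: i => [|[|i]] /=; first by rewrite mul1r.
  by rewrite expr1 mulN1r.
by rewrite mulr0.
Qed.

Lemma chrom_fun_ext G s s' : s =1 s' -> chrom_fun G s = chrom_fun G s'.
Proof. by move=> e; congr chrom_fun; apply: functional_extensionality. Qed.

(* At [p_1 = 1, p_2 = t], only the matchings contribute to the expansion. *)
Lemma chrom_fun_two_point G t : chrom_fun G (two_point t) =
  \sum_(S in powerset (edges G) | small_components S) (- t) ^+ #|S|.
Proof.
rewrite /chrom_fun [RHS]big_mkcondr; apply: eq_bigr => S; rewrite inE => SE.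
rewrite component_weight_two_point => [|e /(subsetP SE)]; last by rewrite inE => /andP[].
by case: ifP => _; rewrite ?mulr0 // -exprMn mulN1r.
Qed.

Definition sorted_pair n (a b : 'I_n) : 'I_n * 'I_n := if (a < b)%N then (a, b) else (b, a).

Lemma sorted_pair_eq n (a b u v : 'I_n) : (u, v) = sorted_pair a b ->
  (u = a /\ v = b) \/ (u = b /\ v = a).
Proof. by rewrite /sorted_pair; case: ifP => _ [-> ->]; [left | right]. Qed.

Lemma sorted_pair_edge G (a b : 'I_(gn G)) : gadj a b -> sorted_pair a b \in edges G.
Proof.
move=> ab; rewrite inE /sorted_pair; case: (ltngtP a b) => [lt|gt|e] /=.
- by rewrite lt.
- by rewrite gt gadj_sym.
by rewrite (val_inj e) gadj_irr in ab.
Qed.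

(* Between [p_2 = 0] and [p_2 = 1] the value of [Y_G] grows by the number of
   nonempty matchings with an even number of edges. *)
Lemma inGamma_near_intersecting G : inGamma (nearSF G) ->
  forall a b c d : 'I_(gn G), gadj a b -> gadj c d -> [|| a == c, a == d, b == c | b == d].
Proof.
move=> gamG a b c d ab cd; apply/contraT; rewrite !negb_or => /and4P[ac ad bc bd].
have r := rep_near (rep_chrom G).
pose A (S : {set 'I_(gn G) * 'I_(gn G)}) := (S \in powerset (edges G)) && small_components S.
(* Averaging over [t] and [- t] keeps the matchings with an even number of edges. *)
have E t : (chrom_fun G (two_point t) + chrom_fun G (signed (two_point t))) / 2%:R =
    \sum_(S | A S && ~~ odd #|S|) t ^+ #|S|.
  rewrite (chrom_fun_ext _ (signed_two_point t)) !chrom_fun_two_point opprK -big_split /=.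
  rewrite mulr_suml [RHS]big_mkcondr; apply: eq_bigr => S _.
  rewrite exprNn -signr_odd; case: odd => /=; first by rewrite mulN1r addNr mul0r.
  by rewrite mul1r -mulr2n -[_ *+ 2]mulr_natr mulfK.
have A0 : A set0.
  rewrite /A inE sub0set; apply: (@small_components_involution _ _ id) => // u v.
  by rewrite /edge_rel !inE.
pose e := sorted_pair a b; pose e' := sorted_pair c d; pose S0 := [set e; e'].
have ee' : e != e'.
  apply/eqP => /esym; case eE : e => [u v] /esym uE.
  have := sorted_pair_eq (esym eE); have := sorted_pair_eq uE.
  by move=> [] [-> ->] [] [x y]; move: ac ad bc bd; rewrite ?x ?y eqxx.
have S0c : #|S0| = 2 by rewrite cards2 ee'.
have AS0 : A S0.
  rewrite /A inE; apply/andP; split.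
    by apply/subsetP => z /set2P[] ->; apply: sorted_pair_edge.
  have Nab : a != b by apply/eqP => h; rewrite h gadj_irr in ab.
  have Ncd : c != d by apply/eqP => h; rewrite h gadj_irr in cd.
  pose f := (tperm a b * tperm c d)%g.
  have fE : (f a = b) * (f b = a) * (f c = d) * (f d = c).
    rewrite !permM tpermL tpermR (tpermD ac bc) (tpermD ad bd) tpermL tpermR.
    by rewrite !tpermD // eq_sym.
  apply: (@small_components_involution _ _ f) => [u|u v].
    case: (tpermP a b u) => [->|->|/eqP ua /eqP ub]; rewrite ?fE //.
    case: (tpermP c d u) => [->|->|/eqP uc /eqP ud]; rewrite ?fE //.
    by rewrite !permM !tpermD // eq_sym.
  by case/orP => /set2P[] /sorted_pair_eq [] [-> ->]; rewrite fE.
have := inGamma_rep_even (s := two_point 0) (s' := two_point 1) gamG r.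
rewrite !E.
have P i : two_point 0 (2 * i)%N = two_point 1 (2 * i)%N by case: i => // i; rewrite mulnS.
have S0n : S0 != set0 by rewrite -card_gt0 S0c.
move/(_ P).
(* The empty matching contributes 1 to both sides. Nothing else remains at $p_2=0$, while [S0] adds
   1 at $p_2=1$. *)
rewrite (bigD1 set0) ?A0 ?cards0 //= [in RHS](bigD1 set0) ?A0 ?cards0 //= expr0.
move/addrI; rewrite big1 => [|S /andP[_ n0]]; last first.
  by rewrite expr0n -[_ == 0%N]negbK -lt0n card_gt0 n0.
rewrite (bigD1 S0) /=; last by rewrite AS0 S0c S0n.
rewrite expr1n => /eqP; rewrite lt_eqF // ltr_pwDl // sumr_ge0 // => S _.
by rewrite expr1n.
Qed.

(** * Linear terms and the classification *)

(** If neither end of an edge $ab$ lies on all edges, there are edges $bc$ and $ac'$ avoiding $a$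
    and $b$ respectively; they meet, so $c=c'$ and the graph contains a triangle. Without isolated
    vertices, nothing else fits. *)
Lemma intersecting_graph (T : finType) (adj : rel T) :
    ssrbool.symmetric adj -> irreflexive adj -> (0 < #|T|)%N -> (forall v, exists w, adj v w) ->
    (forall a b c d, adj a b -> adj c d -> [|| a == c, a == d, b == c | b == d]) ->
  (exists c, forall u v, adj u v = ((u == c) != (v == c))) \/
  (#|T| = 3 /\ forall u v, adj u v = (u != v)).
Proof.
move=> sy ir /card_gt0P[a _] iso meet.
have center c : (forall u v, adj u v -> (u == c) || (v == c)) ->
    forall u v, adj u v = ((u == c) != (v == c)).
  move=> all_c.
  have c_adj v : v != c -> adj c v.
    move=> vc; have [w vw] := iso v; have := all_c _ _ vw.
    by rewrite (negPf vc) /= => /eqP <-; rewrite sy.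
  move=> u v; case: (eqVneq u c) => [->|uc]; case: (eqVneq v c) => [->|vc] /=.
  - by rewrite ir.
  - by rewrite c_adj.
  - by rewrite sy c_adj.
  by apply/negP => /all_c; rewrite (negPf uc) (negPf vc).
have [b ab] := iso a.
have third x y : adj x y -> ~~ [forall u, forall v, adj u v ==> ((u == x) || (v == x))] ->
    exists2 c, adj y c & c != x.
  move=> xy /forallPn[u /forallPn[v]]; rewrite negb_imply negb_or => /and3P[uv ux vx].
  have := meet _ _ _ _ xy uv; rewrite eq_sym (negPf ux) eq_sym (negPf vx) /=.
  by case/orP => /eqP yE; [exists v | exists u]; rewrite ?yE // sy.
case: (boolP [forall u, forall v, adj u v ==> ((u == a) || (v == a))]) => [/'forall_forallP h|na].
  by left; exists a; apply: center => u v uv; have := h u v; rewrite uv.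
case: (boolP [forall u, forall v, adj u v ==> ((u == b) || (v == b))]) => [/'forall_forallP h|nb].
  by left; exists b; apply: center => u v uv; have := h u v; rewrite uv.
have [c bc ca] := third _ _ ab na.
have [|c' ac' c'b] := third b a _ nb; first by rewrite sy.
have neq x y : adj x y -> x != y by apply: contraTneq => ->; rewrite ir.
have cE : c = c'.
  have := meet _ _ _ _ bc ac'; rewrite eq_sym (negPf (neq _ _ ab)) eq_sym (negPf c'b) (negPf ca) /=.
  by move/eqP.
rewrite -{c' c'b}cE in ac'.
have ba := neq _ _ ab; have nbc := neq _ _ bc; have nac := neq _ _ ac'.
(* An edge at a fourth vertex would have its other end on all three sides of the triangle. *)
have abc d : [|| d == a, d == b | d == c].
  have [w dw] := iso d.
  have := meet _ _ _ _ dw ab; have := meet _ _ _ _ dw bc; have := meet _ _ _ _ dw ac'.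
  case: (eqVneq d a) => //= _; case: (eqVneq d b) => //= _; case: (eqVneq d c) => //= _.
  case/orP => /eqP ->; first by rewrite (negPf ba) (negPf nac).
  by rewrite eqxx orbT => _; rewrite (negPf ca) eq_sym (negPf nbc).
right; split.
  rewrite -cardsT (_ : [set: T] = [set a; b; c]); last first.
    by apply/setP => d; rewrite !inE -orbA abc.
  by rewrite -setUA cardsU1 cards2 !inE negb_or ba nac nbc.
move=> u v; case/or3P: (abc u) => /eqP ->; case/or3P: (abc v) => /eqP ->;
  rewrite ?eqxx ?ir ?ab ?bc ?ac' ?ba ?nbc ?nac //= sy ?ab ?bc ?ac' eq_sym ?ba ?nbc ?nac //.
Qed.

Definition axis_point k (t : rat) (i : nat) : rat := if i == (2 * k)%N then t else 0.

(* The coefficient of the linear monomial [p_{2k+1}] in [f] is nonzero. *)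
Definition has_linear_term k (f : SF) : Prop := exists phi (P : {poly rat}),
  [/\ rep f phi, forall t, P.[t] = phi (axis_point k t) & P`_1 != 0].

Lemma axis_poly k phi : polynomial_fun phi ->
  exists P : {poly rat}, forall t, P.[t] = phi (axis_point k t).
Proof.
move=> [m [R E]].
exists (\sum_(a <- msupp R) R@_a *: \prod_i (if val i == (2 * k)%N then 'X else 0) ^+ a i) => t.
rewrite E mevalE horner_sum; apply: eq_bigr => a _; rewrite hornerZ horner_prod; congr (_ * _).
by apply: eq_bigr => i _; rewrite horner_exp /axis_point; case: ifP; rewrite ?hornerX ?horner0.
Qed.

(** Vanishing of the linear coefficient survives products, whatever the constant terms are. *)
Lemma coef1_mul_eq0 (p q : {poly rat}) : p`_1 = 0 -> q`_1 = 0 -> (p * q)`_1 = 0.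
Proof.
by move=> p1 q1; rewrite coefM !big_ord_recl big_ord0 /= p1 q1 mulr0 mul0r !addr0.
Qed.

(* Decomposable elements have no linear part. *)
Lemma generators_linear_term T k : generates_Gamma T ->
  exists2 f, T f & has_linear_term k f.
Proof.
move=> genT; have : inGamma (odd_psum k) by apply/inGammaE/inAlg_gen; exists k.
move=> /genT[m [F [Q [TF pE]]]].
have /fin_all_exists[phi rF] i : exists phi, rep (F i) phi.
  by apply/inGamma_rep/genT/inAlg_gen.
have /fin_all_exists[P PE] i := axis_poly k (proj1 (rF i)).
case: (boolP [exists i, (P i)`_1 != 0]) => [/existsP[i h]|/existsPn h].
  by exists (F i) => //; exists (phi i), (P i).
have P0 i : (P i)`_1 = 0 by apply/eqP; have := h i; rewrite negbK.
(* [Q] evaluated at the generators restricted to the axis, where $p_{2k+1}$ is the variable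
   itself. *)
pose Z := \sum_(a <- msupp Q) Q@_a *: \prod_i (P i) ^+ a i.
have ZX : Z = 'X.
  apply/eqP; rewrite -subr_eq0; apply/eqP/poly_nat_eq0 => t.
  apply/eqP; rewrite hornerD hornerN hornerX subr_eq0; apply/eqP.
  have := rep_sfeval Q rF; rewrite -pE => /(rep_unique (rep_psum _))/(_ (axis_point k t%:R)).
  rewrite {1}/axis_point eqxx => tE; rewrite [RHS]tE mevalE horner_sum; apply: eq_bigr => a _.
  rewrite hornerZ horner_prod; congr (_ * _); apply: eq_bigr => i _.
  by rewrite horner_exp PE.
have : Z`_1 = 0.
  rewrite coef_sum big1 // => a _; rewrite coefZ; apply/eqP; rewrite mulf_eq0; apply/orP; right.
  apply/eqP; apply: (big_ind (fun p : {poly rat} => p`_1 = 0)).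
  - by rewrite coef1.
  - exact: coef1_mul_eq0.
  move=> i _; elim: (a i) => [|e IH]; first by rewrite coef1.
  by rewrite exprS; apply: coef1_mul_eq0.
by rewrite ZX coefX.
Qed.

(** On the axis, [S] contributes $\pm t^c$, with $c$ its number of components, if all of them have
    size $2k+1$, and 0 otherwise. A linear term thus needs an [S] that connects all the vertices. *)
Lemma near_linear_term G k : has_linear_term k (nearSF G) ->
  gn G = (2 * k).+1 /\ (k != 0 -> forall v : 'I_(gn G), exists w, gadj v w)%N.
Proof.
move=> [phi [P [r PE P1]]].
pose cc S (v : 'I_(gn G)) := #|connect (edge_rel S) v|.
pose W S : {poly rat} := \prod_(r in roots (edge_rel S)) (if (cc S r).-1 == (2 * k)%N then 'X else 0).
have PW : P = \sum_(S in powerset (edges G)) (-1) ^+ #|S| *: W S.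
  apply/eqP; rewrite -subr_eq0; apply/eqP/poly_nat_eq0 => t.
  apply/eqP; rewrite hornerD hornerN subr_eq0; apply/eqP.
  rewrite PE (rep_unique r (rep_near (rep_chrom G))).
  (* The only nonzero coordinate has even index $2k$, so [omega] changes nothing on the axis. *)
  have -> : chrom_fun G (signed (axis_point k t%:R)) = chrom_fun G (axis_point k t%:R).
    apply: chrom_fun_ext => i; rewrite /signed /axis_point; case: eqP => [->|_]; last by rewrite mulr0.
    by rewrite exprM sqrrN !expr1n mul1r.
  rewrite -mulr2n -[_ *+ 2]mulr_natr mulfK // horner_sum; apply: eq_bigr => S _.
  rewrite hornerZ /component_weight horner_prod; congr (_ * _); apply: eq_bigr => v _.
  by rewrite /axis_point; case: ifP; rewrite ?hornerX ?horner0.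
have [S SE WS] : exists2 S : {set 'I_(gn G) * 'I_(gn G)}, S \subset edges G & (W S)`_1 != 0.
  case: (boolP [exists S : {set 'I_(gn G) * 'I_(gn G)} in powerset (edges G), (W S)`_1 != 0]) => [/exists_inP[S]|/exists_inPn h].
    by rewrite inE; exists S.
  case/eqP: P1; rewrite PW coef_sum big1 // => S /h; rewrite negbK coefZ => /eqP ->.
  by rewrite mulr0.
have cE v : v \in roots (edge_rel S) -> cc S v = (2 * k).+1.
  move=> rv; have c0 : (0 < cc S v)%N by apply/card_gt0P; exists v; apply: connect0.
  have : (cc S v).-1 == (2 * k)%N; last by move/eqP <-; rewrite prednK.
  by apply: contraNT WS => ne; rewrite /W (bigD1 v) //= (negPf ne) mul0r coef0.
have WX : W S = 'X ^+ #|roots (edge_rel S)|.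
  by rewrite /W -prodr_const; apply: eq_bigr => v rv; rewrite cE //= eqxx.
have r1 : #|roots (edge_rel S)| = 1%N.
  by move: WS; rewrite WX coefXn; case: (eqVneq 1%N #|roots (edge_rel S)|) => [<- //|_]; rewrite eqxx.
split.
  rewrite -[LHS]card_ord -(sum_card_component (edge_rel_sym S)).
  by rewrite (eq_bigr (fun=> (2 * k).+1)) ?sum_nat_const ?r1 ?mul1n.
move=> k0 v; have sy := edge_rel_sym S.
have c : cc S v = (2 * k).+1.
  rewrite -(cE _ (roots_root sy v)); apply: eq_card => w.
  by rewrite !unfold_in; apply: same_connect => //; apply: connect_root.
have [|w vw] := @mem_connect_other _ (edge_rel S) v; first by move: c; rewrite /cc => ->; lia.
exists w; case/orP: vw => /(subsetP SE); rewrite inE => /andP[_] //=.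
by rewrite gadj_sym.
Qed.

Lemma near_linear_gamma G k : has_linear_term k (nearSF G) -> inGamma (nearSF G) ->
  nearSF G = nearSF (star (2 * k).+1) \/ (k = 1%N /\ nearSF G = nearSF C3).
Proof.
move=> /near_linear_term[gnE iso] /inGamma_near_intersecting meet.
have starE (c : 'I_(gn G)) : (forall u v, gadj u v = ((u == c) != (v == c))) ->
    nearSF G = nearSF (star (2 * k).+1).
  by move=> h; apply: rep_inj (rep_near_star gnE h) (rep_near_star_odd k) _.
(* For $k=0$ the graph is a single isolated vertex, the star $S_1$, which [intersecting_graph]
   excludes. *)
case: (eqVneq k 0%N) => [k0|k0].
  left; have c : 'I_(gn G) by rewrite gnE; exact: ord0.
  have val0 (u : 'I_(gn G)) : val u = 0%N.
    by have := ltn_ord u; rewrite [X in (_ < X)%N]gnE k0 ltnS leqn0 => /eqP.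
  have allc (u : 'I_(gn G)) : u = c by apply: val_inj; rewrite !val0.
  by apply: (starE c) => u v; rewrite !(allc u) !(allc v) eqxx gadj_irr.
have V0 : (0 < #|'I_(gn G)|)%N by rewrite card_ord gnE.
case: (intersecting_graph (@gadj_sym G) (@gadj_irr G) V0 (iso k0) meet).
  by case=> c /starE; left.
rewrite card_ord => -[gn3 neq]; right.
have k1 : k = 1%N by lia.
split=> //.
apply: rep_inj (rep_near_complete3 gn3 neq) _ _; last by move=> s.
exact: (@rep_near_complete3 C3 erefl (fun u v => erefl)).
Qed.

Theorem mainTheorem5 :
  (alg_indep setA /\ generates_Gamma setA) /\
  (alg_indep setB /\ generates_Gamma setB) /\
  (forall T : SF -> Prop,
      (forall f, T f -> exists G : graph, f = nearSF G) ->
      alg_indep T -> generates_Gamma T ->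
      (forall f, T f <-> setA f) \/ (forall f, T f <-> setB f)).
Proof.
have tA := triangular_famA; have tB := triangular_famB.
split; first by split; [exact: triangular_alg_indep tA | exact: triangular_generates tA].
split; first by split; [exact: triangular_alg_indep tB | exact: triangular_generates tB].
move=> T near_T indT genT.
have T_near k : T (nearSF (star (2 * k).+1)) \/ (k = 1%N /\ T (nearSF C3)).
  have [f Tf lin] := generators_linear_term k genT.
  have [G fE] := near_T f Tf.
  have gf : inGamma f by apply/genT/inAlg_gen.
  rewrite fE in Tf lin gf.
  by case: (near_linear_gamma lin gf) => [<-|[k1 <-]]; [left | right].
have T_star k : k <> 1%N -> T (nearSF (star (2 * k).+1)) by case: (T_near k) => [|[]].
(* Only index 1 leaves a choice, between $S_3$ and $C_3$; either way [T] contains a whole family,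
   and maximality gives equality. *)
case: (T_near 1%N) => [T3|[_ T3]]; [right | left].
  apply: (triangular_maximal tB) => // _ [k ->].
  by case: (eqVneq k 1%N) => [->|/eqP/T_star].
apply: (triangular_maximal tA) => // _ [k ->]; rewrite /famA.
by case: eqP => [|/T_star].
Qed.
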